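(* Fix a positive integer $d$ and a tuple of non-negative integers $\mathbf{w}=(w_0,w_1,\dots,w_{d-1})$ with $w_{d-1}\ge 1$. Set $W=\max\{w_0,\dots,w_{d-1}\}$ and let $c_{\mathbf{w}}$ be the unique positive real root of the polynomial $$P_{\mathbf{w}}(x)=(x-1)\sum_{j=0}^{d-1} w_j x^j - W x^{d-1}.$$ Let $\{a_n\}_{n=1}^\infty$ and $\{b_n\}_{n=1}^\infty$ be sequences of positive integers, with $\{a_n\}$ non-decreasing. Assume there exist real numbers $0<\eta<\tau$ such that for all $n\in\mathbb{N}$ $$b_n\le n^\eta,\qquad a_n^{w_0}a_{n+1}^{w_1}\cdots a_{n+d-1}^{w_{d-1}}\ge n^{1+\tau},$$ and assume further that $\limsup_{n\to\infty} a_n^{1/c_{\mathbf{w}}^n}=\infty$. Then the sum $$\sum_{n=1}^\infty \frac{b_n}{a_n^{w_0}a_{n+1}^{w_1}\cdots a_{n+d-1}^{w_{d-1}}}$$ is irrational.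
   Context: ''Monotonically increasing'' means non-decreasing. The polynomial $P_{\mathbf{w}}$ has exactly one positive root, and it lies in $(1,\infty)$. *)

(* Defs.v *)
From HB Require Import structures.
From mathcomp Require Import all_boot all_order all_algebra.
From mathcomp Require Import all_classical all_reals all_analysis.
From mathcomp Require Import ring.

Set Implicit Arguments.
Unset Strict Implicit.
Unset Printing Implicit Defensive.

Import Order.TTheory GRing.Theory Num.Theory.
Import numFieldNormedType.Exports.

Local Open Scope ring_scope.

Definition max_weight (d : nat) (w : d.-tuple nat) : nat :=
  (\max_(j < d) nth 0 w j)%N.

Definition weight_poly (R : realType) (d : nat) (w : d.-tuple nat) : {poly R} :=
  ('X - 1) * (\sum_(j < d) (nth 0%N w j)%:R *: 'X^j)
  - (max_weight w)%:R *: 'X^(d.-1).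

Definition weighted_prod (d : nat) (w : d.-tuple nat) (a : nat -> nat) (n : nat)
    : nat :=
  (\prod_(j < d) a (n + j) ^ nth 0 w j)%N.

(* Justifies speaking of "the" positive root of [weight_poly]. *)
Section UniquePositiveRoot.
Variables (R : realType) (d : nat) (w : d.-tuple nat).
Hypotheses (d_gt0 : (0 < d)%N) (wlast_gt0 : (0 < nth 0 w d.-1)%N).

Let W := max_weight w.
Let P : {poly R} := weight_poly R w.

Let le_W (j : nat) : (j < d)%N -> (nth 0 w j <= W)%N.
Proof. by move=> jd; exact: (leq_bigmax (Ordinal jd)). Qed.

Let W_gt0 : (0 < W)%N.
Proof. by apply: (leq_trans wlast_gt0); apply: le_W; rewrite prednK. Qed.

Let PE (x : R) : P.[x] =
  (x - 1) * (\sum_(j < d) (nth 0%N w j)%:R * x ^+ j) - W%:R * x ^+ d.-1.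
Proof.
rewrite /P /weight_poly !hornerE horner_sum; congr (_ * _ - _).
by apply: eq_bigr => j _; rewrite !hornerE.
Qed.

Let h (x : R) : R := (nth 0%N w d.-1)%:R * x ^+ d.-1
  - \sum_(j < d.-1) (W - nth 0 w j)%:R * x ^+ j.

Let PhE (x : R) : P.[x] = (x - 1) * h x - W%:R.
Proof.
rewrite PE /h -(big_mkord xpredT (fun j => (nth 0%N w j)%:R * x ^+ j)).
rewrite -{1}(prednK d_gt0) big_nat_recr //= big_mkord.
have -> : \sum_(j < d.-1) (W - nth 0 w j)%:R * x ^+ j =
    W%:R * (\sum_(j < d.-1) x ^+ j) - \sum_(j < d.-1) (nth 0%N w j)%:R * x ^+ j.
  rewrite mulr_sumr -sumrB; apply: eq_bigr => j _.
  rewrite natrB ?mulrBl// le_W//.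
  by rewrite (leq_trans (ltn_ord j))// leq_pred.
have xd : x ^+ d.-1 = (x - 1) * (\sum_(j < d.-1) x ^+ j) + 1.
  by rewrite -subrX1 subrK.
rewrite [in X in _ - W%:R * X]xd; ring.
Qed.

Let root_gt1 (x : R) : 0 < x -> root P x -> 1 < x.
Proof.
move=> x0 /rootP; rewrite PE => /eqP; rewrite subr_eq0 => /eqP Px.
have: 0 < (x - 1) * \sum_(j < d) (nth 0%N w j)%:R * x ^+ j.
  by rewrite Px mulr_gt0 ?exprn_gt0 ?ltr0n.
rewrite pmulr_lgt0 ?subr_gt0//.
have jd : (d.-1 < d)%N by rewrite prednK.
rewrite (bigD1 (Ordinal jd))//= ltr_pwDl ?mulr_gt0 ?exprn_gt0 ?ltr0n//.
by apply: sumr_ge0 => j _; rewrite mulr_ge0 ?ler0n ?exprn_ge0 ?ltW.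
Qed.

Let root_inj (x y : R) : 1 < x -> x < y -> root P x -> ~ root P y.
Proof.
move=> x1 xy /rootP Px /rootP Py.
have x0 : 0 < x by rewrite (lt_trans ltr01).
move: Px Py; rewrite !PhE => /eqP; rewrite subr_eq0 => /eqP Px.
move=> /eqP; rewrite subr_eq0 => /eqP Py.
have hx : 0 < h x.
  have : 0 < (x - 1) * h x by rewrite Px ltr0n.
  by rewrite pmulr_rgt0 ?subr_gt0.
pose t := y / x.
have t1 : 1 <= t by rewrite ler_pdivlMr// mul1r ltW.
have yE : y = t * x by rewrite /t divfK ?gt_eqF.
clearbody t.
have hxy : h x <= h y.
  apply: (@le_trans _ _ (t ^+ d.-1 * h x)).
    by rewrite ler_peMl ?exprn_ege1//; exact: ltW.
  rewrite /h mulrBr mulr_sumr lerB//.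
    by rewrite yE exprMn mulrCA.
  apply: ler_sum => j _; rewrite mulrCA ler_wpM2l ?ler0n// yE exprMn.
  rewrite ler_wpM2r//; first by rewrite exprn_ge0// ltW.
  by rewrite ler_weXn2l// ltnW.
have : (x - 1) * h x < (y - 1) * h y.
  apply: (@lt_le_trans _ _ ((y - 1) * h x)).
    by rewrite ltr_pM2r// ltrD2r.
  by rewrite ler_wpM2l// subr_ge0 ltW// (lt_trans x1).
by rewrite Px Py ltxx.
Qed.

Lemma weight_poly_unique_pos_root :
  exists! c : R, 0 < c /\ root (weight_poly R w) c.
Proof.
have W1 : 1 <= W%:R + 1 :> R by rewrite lerDr ler0n.
have P1 : P.[1] <= 0 by rewrite PE subrr mul0r sub0r expr1n mulr1 oppr_le0.
have PW : 0 <= P.[W%:R + 1].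
  rewrite PE addrK -mulrBr mulr_ge0 ?ler0n// subr_ge0.
  have jd : (d.-1 < d)%N by rewrite prednK.
  rewrite (bigD1 (Ordinal jd))//= -[leLHS]addr0 lerD//.
    by rewrite ler_peMl ?ler1n// exprn_ge0// (le_trans ler01).
  by apply: sumr_ge0 => j _; rewrite mulr_ge0 ?ler0n// exprn_ge0.
have := @poly_ivt _ P 1 (W%:R + 1) W1.
rewrite P1 PW => /(_ isT) [c /andP[c1 _] rc].
exists c; split; first by split => //; rewrite (lt_le_trans ltr01).
move=> y [y0 ry]; have y1 := root_gt1 y0 ry.
have {}c1 := root_gt1 (lt_le_trans ltr01 c1) rc.
by case: (ltgtP c y) => // lt_xy; exfalso;
  [apply: (root_inj c1 lt_xy) | apply: (root_inj y1 lt_xy)].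
Qed.

End UniquePositiveRoot.

(* Main.v *)
Require Import Defs.
From HB Require Import structures.
From mathcomp Require Import all_boot all_order all_algebra.
From mathcomp Require Import all_classical all_reals all_analysis.
From mathcomp Require Import lra ring zify.

Import Order.TTheory GRing.Theory Num.Theory.
Import numFieldNormedType.Exports.

Local Open Scope classical_set_scope.
Local Open Scope ring_scope.

(* Write [d = D + 1], [x i = ln (a i)], let [A n] be the [n]-th weighted product
   and [L N] the product of the [a i ^ W] for [0 < i < N + D], a common multiple
   of [A 1, ..., A (N - 1)].  If the sum is [p / q], the tail [T N] is at least
   [1 / (q L N)], while the growth hypotheses give [T N <= C (A N) ^ (- kappa)].
   Call [m] a jump if [ln (A m) >= ln (L m) + G m].  The terms from [m] to [m ^ 2]
   are then negligible against [1 / (q L m)], so [T n >= 1 / (2 q L m)] and hence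
   [ln (A n) <= (C0 + ln (L m)) / kappa] for all [m <= n <= m ^ 2]: after a jump
   the sequence stalls so long that [ln (L (m ^ 2))] is negligible compared with
   [c ^ (m ^ 2)].  Away from jumps, [x] satisfies a linear recursive inequality
   with nonnegative coefficients and dominant root [c], so [x n] stays below
   [M c ^ n - Z mu ^ n] for some [1 < mu < c].  Alternating the two regimes gives
   [x n = O(c ^ n)], which contradicts the limsup hypothesis. *)

Lemma mulnn_le_exp4 (n : nat) : (n * n <= 4 ^ n)%N.
Proof.
elim: n => // n IH; have [->//|n0] := posnP n.
rewrite expnS (leq_trans _ (leq_mul (leqnn 4) IH))//.
by rewrite -[4%N]/(2 * 2)%N mulnACA leq_mul//; lia.
Qed.

(** * Linear recursive inequalities with nonnegative coefficients *)

Section LinearRecurrence.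
Context {R : archiRealFieldType} (D : nat) (v : nat -> R) (W : R).
Hypothesis v_ge0 : forall j, 0 <= v j.
Hypothesis v_le : forall j, v j <= W.
Hypothesis v_lead : 1 <= v D.

(* For [x i = ln (a i)], [window x n] and [history x n] are the logarithms of
   [A n] and [L n]. *)
Definition window (x : nat -> R) (n : nat) : R :=
  \sum_(j < D.+1) v j * x (n + j)%N.

Definition history (x : nat -> R) (n : nat) : R :=
  W * \sum_(1 <= i < n + D) x i.

(** This is [weight_poly] as a function, for real weights. Its sign decides whether the window of
    the geometric sequence of ratio [z] outgrows the history in the long run. *)
Definition char_fun (z : R) : R :=
  (z - 1) * (\sum_(j < D.+1) v j * z ^+ j) - W * z ^+ D.

Let W_ge1 : 1 <= W. Proof. exact: le_trans v_lead (v_le D). Qed.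

Let W_ge0 : 0 <= W. Proof. exact: le_trans ler01 W_ge1. Qed.

Lemma sum_expr_nat (z : R) (n : nat) : 1 < z -> (0 < n)%N ->
  \sum_(1 <= i < n) z ^+ i = (z ^+ n - z) / (z - 1).
Proof.
move=> z1; have z10 : z - 1 != 0 by rewrite subr_eq0 gt_eqF.
elim: n => // -[|n] IH _; first by rewrite big_geq// expr1 subrr mul0r.
by rewrite big_nat_recr//= IH// [in RHS]exprS; field.
Qed.

(** Summing the geometric series leaves an exponential part, carried by [char_fun z], and a positive
    constant. At the root [c] only the constant survives; where [char_fun mu < 0], subtracting a
    multiple of [mu ^+ n] yields an exponential gain. *)
Lemma window_sub_history_expr (z : R) (m : nat) : 1 < z -> (0 < m)%N ->
  window (fun i => z ^+ i) m - history (fun i => z ^+ i) m =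
  (z ^+ m * char_fun z + W * z) / (z - 1).
Proof.
move=> z1 m0; have z10 : z - 1 != 0 by rewrite subr_eq0 gt_eqF.
rewrite /window /history sum_expr_nat ?addn_gt0 ?m0// /char_fun.
have -> : \sum_(j < D.+1) v j * z ^+ (m + j) =
    z ^+ m * \sum_(j < D.+1) v j * z ^+ j.
  by rewrite mulr_sumr; apply: eq_bigr => j _; rewrite exprD mulrCA.
by rewrite exprD; field.
Qed.

Lemma char_fun_root_gt1 (c : R) : 0 < c -> char_fun c = 0 -> 1 < c.
Proof.
move=> c0 /eqP; rewrite /char_fun subr_eq0 => /eqP Pc.
have : 0 < (c - 1) * \sum_(j < D.+1) v j * c ^+ j.
  by rewrite Pc mulr_gt0 ?exprn_gt0// (lt_le_trans ltr01).
rewrite ltNge; apply: contraNT; rewrite -leNgt => c1.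
rewrite mulr_le0_ge0 ?subr_le0//; apply: sumr_ge0 => j _.
by rewrite mulr_ge0// exprn_ge0// ltW.
Qed.

(** Just above 1, the factor [z - 1] makes the first term of [char_fun] small against
    [W * z ^+ D]. *)
Lemma exists_char_fun_lt0 (c : R) : 1 < c ->
  exists mu : R, [/\ 1 < mu, mu < c & char_fun mu < 0].
Proof.
(* The first bound keeps [1 + e] below [c]. The second gives [e * (D + 1) < 1], which beats the
   [D + 1] summands, each at most [W * (1 + e) ^+ D]. *)
move=> c1; pose e := Num.min ((c - 1) / 2) (D.+2%:R^-1).
have e0 : 0 < e by rewrite lt_min invr_gt0 ltr0n andbT divr_gt0// subr_gt0.
have ec : e <= (c - 1) / 2 by rewrite ge_min lexx.
have eD : e * D.+2%:R <= 1.
  by rewrite -ler_pdivlMr ?ltr0n// mul1r ge_min lexx orbT.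
exists (1 + e); split; [by rewrite ltrDl | by lra |].
have mu1 : 1 <= 1 + e by rewrite lerDl ltW.
rewrite /char_fun subr_lt0 addrAC subrr add0r.
have : \sum_(j < D.+1) v j * (1 + e) ^+ j <= D.+1%:R * (W * (1 + e) ^+ D).
  rewrite mulr_natl -[in leRHS](card_ord D.+1) -sumr_const; apply: ler_sum => j _.
  apply: ler_pM => //; first by rewrite exprn_ge0// (le_trans ler01).
  by rewrite ler_weXn2l// -ltnS.
rewrite -(ler_pM2l e0) => /le_lt_trans; apply.
rewrite [ltLHS]mulrA -[ltRHS]mul1r ltr_pM2r.
  by apply: lt_le_trans eD; rewrite ltr_pM2l// ltr_nat.
by rewrite mulr_gt0 ?exprn_gt0 ?(lt_le_trans ltr01).
Qed.

(* The coefficients [W - v j] are nonnegative, so the recurrence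
   [window u m = history u m] propagates nonnegativity. *)
Lemma window_max_principle (u : nat -> R) (m : nat) : (0 < m)%N ->
  (forall i, (0 < i < m + D)%N -> 0 <= u i) ->
  history u m <= window u m -> 0 <= u (m + D)%N.
Proof.
move=> m0 u0; rewrite /history /window big_ord_recr/= => le_hw.
have vD0 : 0 < v D by exact: lt_le_trans v_lead.
rewrite -(pmulr_rge0 _ vD0).
suff : \sum_(j < D) v j * u (m + j)%N <= W * \sum_(1 <= i < m + D) u i by lra.
rewrite (@big_cat_nat _ _ _ m)//=; last exact: leq_addr.
rewrite mulrDr -[leLHS]add0r lerD//.
  rewrite mulr_ge0// big_nat_cond sumr_ge0// => i; rewrite andbT => /andP[i0 im].
  by rewrite u0// i0 (leq_trans im)// leq_addr.
rewrite -[X in \sum_(X <= _ < _) _]add0n big_addn addKn big_mkord mulr_sumr.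
apply: ler_sum => j _; rewrite [(j + m)%N]addnC ler_wpM2r// u0//.
by rewrite addn_gt0 m0 ltn_add2l/=.
Qed.

Lemma history_cat (x : nat -> R) (m n : nat) : (0 < m)%N -> (m <= n)%N ->
  history x n = history x m + W * \sum_(m + D <= i < n + D) x i.
Proof.
move=> m0 mn; rewrite /history -mulrDr -big_cat_nat//= ?leq_add2r//.
by rewrite addn_gt0 m0.
Qed.

Lemma window_ge_last (x : nat -> R) (n : nat) : (0 < n)%N ->
  (forall i, (0 < i)%N -> 0 <= x i) -> x (n + D)%N <= window x n.
Proof.
move=> n0 x0; rewrite /window big_ord_recr/= -[leLHS]add0r lerD//.
  by rewrite sumr_ge0// => j _; rewrite mulr_ge0// x0// addn_gt0 n0.
by rewrite ler_peMl// x0// addn_gt0 n0.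
Qed.

Lemma history_ge0 (x : nat -> R) (n : nat) :
  (forall i, (0 < i)%N -> 0 <= x i) -> 0 <= history x n.
Proof.
move=> x0; rewrite /history mulr_ge0// big_nat_cond sumr_ge0// => i.
by rewrite andbT => /andP[i0 _]; exact: x0.
Qed.

(** Replacing [x] by zero before [K + D] makes [V] dominate there for free; the discarded mass is
    the term [history x K] in the hypothesis on [V]. From there [window_max_principle] carries the
    domination forward. *)
Lemma window_comparison (x V : nat -> R) (g : nat -> R) (K n : nat) :
  (0 < K)%N -> (forall i, (0 < i)%N -> 0 <= x i) -> (forall i, 0 <= V i) ->
  (forall m, (K <= m < n)%N -> window x m <= history x m + g m) ->
  (forall m, (K <= m)%N ->
    history V m + (history x K + g m) <= window V m) ->
  forall m, (K <= m < n)%N -> x (m + D)%N <= V (m + D)%N.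
Proof.
move=> K0 x0 V0 hx hV.
pose u i := V i - (if (i < K + D)%N then 0 else x i).
suff u0 m : (K <= m < n)%N -> 0 <= u (m + D)%N.
  move=> m Kmn; have := u0 m Kmn; rewrite /u ltn_add2r.
  by move: (Kmn) => /andP[Km _]; rewrite ltnNge Km/= subr_ge0.
elim/ltn_ind: m => m IH /andP[Km mn].
have m0 : (0 < m)%N by exact: leq_trans Km.
apply: window_max_principle => // [i /andP[i0 im]|].
  have [iK|Ki] := ltnP i (K + D); first by rewrite /u iK subr0.
  have Di : (D <= i)%N by rewrite (leq_trans _ Ki)// leq_addl.
  rewrite -(subnK Di); apply: IH; first by rewrite ltn_subLR// addnC.
  by rewrite leq_subRL// addnC Ki/= (leq_trans _ mn)// ltnS ltnW// ltn_subLR// addnC.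
pose x' i := if (i < K + D)%N then 0 else x i.
have uE : u = fun i => V i - x' i by [].
have hu : history u m = history V m - history x' m.
  by rewrite /history -mulrBr -sumrB.
have wu : window u m = window V m - window x' m.
  by rewrite /window -sumrB; apply: eq_bigr => j _; rewrite uE mulrBr.
(* Truncation can only lower the window, while it lowers the history by exactly [history x K]. *)
have wx' : window x' m <= window x m.
  apply: ler_sum => j _; rewrite ler_wpM2l// /x'; case: ifPn => // _.
  by rewrite x0// addn_gt0 m0.
have hx' : history x' m = history x m - history x K.
  rewrite (history_cat x K m)// addrC addKr.
  rewrite (history_cat x' K m)//.
  rewrite {1}/history big_nat_cond big1 ?mulr0 ?add0r; last first.
    by move=> i; rewrite andbT => /andP[_ iK]; rewrite /x' iK.
  congr (_ * _); rewrite big_nat_cond [RHS]big_nat_cond; apply: eq_bigr => i.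
  by rewrite andbT => /andP[Ki _]; rewrite /x' ltnNge Ki.
have := hx m; rewrite Km mn => /(_ isT) hxm.
have := hV m Km; rewrite hu wu; lra.
Qed.

Lemma bernoulli_le (z : R) (n : nat) : 1 <= z -> 1 + (z - 1) * n%:R <= z ^+ n.
Proof.
move=> z1; elim: n => [|n IH]; first by rewrite mulr0 addr0 expr0.
rewrite exprS -natr1; move: IH.
rewrite -(ler_pM2l (lt_le_trans ltr01 z1)); apply: le_trans.
have : 0 <= (z - 1) * ((z - 1) * n%:R) by rewrite !mulr_ge0 ?subr_ge0.
lra.
Qed.

(** Since [mu ^+ (m * m)] is the [m]-th power of [mu ^+ m], it suffices that [mu ^+ m >= C * 4 * c],
    which Bernoulli gives for large [m]; the factor [4 ^+ m] absorbs [m * m]. *)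
Lemma exp_square_dominates (c mu C : R) : 1 <= c -> 1 < mu -> 1 <= C ->
  exists2 K : nat, (1 < K)%N & forall m, (K <= m)%N ->
    C * (m * m)%:R * c ^+ m <= mu ^+ (m * m).
Proof.
move=> c1 mu1 C1; have c0 : 0 <= c by exact: le_trans c1.
have C0 : 0 <= C by exact: le_trans C1.
have e0 : 0 < mu - 1 by rewrite subr_gt0.
pose X := C * 4 * c / (mu - 1); pose K := (Num.bound X).+2.
exists K => // m Km.
have X0 : 0 <= X by rewrite divr_ge0 ?mulr_ge0// ltW.
have Xm : X <= m%:R.
  rewrite (le_trans (ltW (archi_boundP X0)))// ler_nat.
  by rewrite (leq_trans _ Km)// /K -addn2 leq_addr.
have mum : C * 4 * c <= mu ^+ m.
  have := bernoulli_le mu m (ltW mu1).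
  move: Xm; rewrite /X ler_pdivrMr// mulrC; lra.
have m0 : (0 < m)%N by rewrite (leq_trans _ Km).
rewrite exprM; apply: (@le_trans _ _ ((C * 4 * c) ^+ m)); last first.
  by rewrite lerXn2r// ?nnegrE ?mulr_ge0// exprn_ge0// (le_trans ler01)// ltW.
rewrite !exprMn ler_wpM2r ?exprn_ge0//; apply: ler_pM => //.
  by rewrite -[leLHS]expr1 ler_weXn2l.
by rewrite -natrX ler_nat mulnn_le_exp4.
Qed.

(** * Alternation of quiet phases, jumps and stalls *)

Section Dynamics.
Variables (x : nat -> R) (c kappa C0 G : R).
Hypothesis x_ge0 : forall i, (0 < i)%N -> 0 <= x i.
Hypothesis c_gt1 : 1 < c.
Hypothesis c_root : char_fun c = 0.
Hypothesis kappa_gt0 : 0 < kappa.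
Hypothesis C0_ge0 : 0 <= C0.
Hypothesis G_ge0 : 0 <= G.
Hypothesis slow_after_jump : forall m n, (0 < m)%N -> (m <= n <= m * m)%N ->
  history x m + G * m%:R <= window x m ->
  kappa * window x n <= C0 + history x m.

(** Induction over restart times [K] with [history x K <= H * mu ^+ K]. From [K] on, either no jump
    occurs up to the target and [V] bounds [x], or the first jump [m] opens a stall up to [m * m],
    the next restart time. *)
Lemma window_exp_bounded :
  exists B : R, exists N : nat, forall n, (N <= n)%N -> x n <= B * c ^+ n.
Proof.
have [mu [mu1 muc Pmu]] := exists_char_fun_lt0 c c_gt1.
have mu0 : 0 < mu by exact: lt_trans mu1.
have c0 : 0 < c by exact: lt_trans c_gt1.
have mu10 : 0 < mu - 1 by rewrite subr_gt0.
have c10 : 0 < c - 1 by rewrite subr_gt0.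
have muX1 n : 1 <= mu ^+ n by rewrite exprn_ege1// ltW.
have cX1 n : 1 <= c ^+ n by rewrite exprn_ege1// ltW.
have muX0 n : 0 <= mu ^+ n by exact: le_trans (muX1 n).
have cX0 n : 0 <= c ^+ n by exact: le_trans (cX1 n).
have mucX n : mu ^+ n <= c ^+ n by apply: lerXn2r; rewrite ?nnegrE ltW.
pose C3 := G / (mu - 1).
have C3_ge0 : 0 <= C3 by rewrite divr_ge0// ltW.
have G_le m : G * m%:R <= C3 * mu ^+ m.
  have bm := bernoulli_le mu m (ltW mu1).
  rewrite /C3 mulrAC ler_pdivlMr// -mulrA ler_wpM2l// mulrC; lra.
pose rho := - char_fun mu / (mu - 1).
have rho0 : 0 < rho by rewrite divr_gt0// oppr_gt0.
(* The summand 1 makes [V] nonnegative; the other lets the constant produced by [c] absorb the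
   constant [Z1 * W * mu / (mu - 1)] produced by [mu]. *)
pose t := 1 + mu * (c - 1) / (c * (mu - 1)).
have t_ge1 : 1 <= t.
  by rewrite lerDl divr_ge0// mulr_ge0// ltW.
(* The gain per unit of [mu ^+ m] is [Z1 * rho = 1 + C3]: the 1 pays for [history x K], and [C3] for
   the jump threshold [G * m]. *)
pose Z1 := (1 + C3) / rho; pose M1 := t * Z1.
have Z1_ge0 : 0 <= Z1 by rewrite divr_ge0 ?addr_ge0// ltW.
have M1_ge0 : 0 <= M1 by rewrite mulr_ge0// (le_trans ler01).
(* In units of [H * c ^+ m], [C4] bounds the history at a jump [m], [C5] the windows during the
   stall, and [C6 * (m * m)] the history at its end. *)
pose C4 := 1 + W * M1 * c ^+ D / (c - 1).
have C4_ge1 : 1 <= C4.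
  by rewrite lerDl (divr_ge0 (mulr_ge0 (mulr_ge0 W_ge0 M1_ge0) (cX0 D)) (ltW c10)).
pose C5 := (C0 + C4) / kappa.
have C5_ge0 : 0 <= C5.
  exact: divr_ge0 (addr_ge0 C0_ge0 (le_trans ler01 C4_ge1)) (ltW kappa_gt0).
pose C6 := C4 + W * C5.
have C6_ge1 : 1 <= C6 by rewrite (le_trans C4_ge1)// lerDl (mulr_ge0 W_ge0 C5_ge0).
have [K0 K0_gt1 K0P] := exp_square_dominates c mu C6 (ltW c_gt1) mu1 C6_ge1.
pose H := 1 + history x K0.
have H_ge1 : 1 <= H by rewrite lerDl history_ge0.
have H_ge0 : 0 <= H by exact: le_trans H_ge1.
pose V i := H * (M1 * c ^+ i - Z1 * mu ^+ i).
have V_ge0 i : 0 <= V i.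
  rewrite (mulr_ge0 H_ge0)// subr_ge0 (ler_pM Z1_ge0 (muX0 i))//.
  by rewrite /M1 (ler_peMl Z1_ge0).
have V_le i : V i <= H * M1 * c ^+ i.
  by rewrite /V mulrBr -mulrA gerBl (mulr_ge0 H_ge0 (mulr_ge0 Z1_ge0 (muX0 i))).
have V_super m : (0 < m)%N ->
    history V m + H * (1 + C3) * mu ^+ m <= window V m.
  move=> m0.
  have wV : window V m = H * (M1 * window (fun i => c ^+ i) m
                              - Z1 * window (fun i => mu ^+ i) m).
    rewrite /window !mulr_sumr -sumrB mulr_sumr; apply: eq_bigr => j _.
    by rewrite /V; ring.
  have hV : history V m = H * (M1 * history (fun i => c ^+ i) m
                              - Z1 * history (fun i => mu ^+ i) m).
    by rewrite /history /V -mulr_sumr sumrB -!mulr_sumr; ring.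
  have := window_sub_history_expr c m c_gt1 m0.
  have := window_sub_history_expr mu m mu1 m0.
  rewrite c_root mulr0 add0r => Emu Ec.
  rewrite wV hV -subr_ge0.
  have -> : forall a b a' b' : R, H * (M1 * a - Z1 * b) -
     (H * (M1 * a' - Z1 * b') + H * (1 + C3) * mu ^+ m) =
     H * (M1 * (a - a') - Z1 * (b - b') - (1 + C3) * mu ^+ m).
    by move=> a b a' b'; ring.
  rewrite Emu Ec (mulr_ge0 H_ge0)//.
  have -> : M1 * (W * c / (c - 1)) -
      Z1 * ((mu ^+ m * char_fun mu + W * mu) / (mu - 1)) - (1 + C3) * mu ^+ m
      = Z1 * W * (c / (c - 1)) + (Z1 * rho - (1 + C3)) * mu ^+ m.
    rewrite /M1 /t /rho; field.
    by rewrite !gt_eqF.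
  rewrite {2}/Z1 divfK ?gt_eqF// subrr mul0r addr0.
  exact: mulr_ge0 (mulr_ge0 Z1_ge0 W_ge0) (divr_ge0 (ltW c0) (ltW c10)).
have quiet_phase K m : (0 < K)%N -> (K <= m)%N -> history x K <= H * mu ^+ K ->
    (forall k, (K <= k < m)%N -> window x k < history x k + G * k%:R) ->
    (forall k, (K <= k < m)%N -> x (k + D)%N <= V (k + D)%N) /\
    history x m <= H * C4 * c ^+ m.
  move=> Kpos Km hK nojump.
  have xV k : (K <= k < m)%N -> x (k + D)%N <= V (k + D)%N.
    apply: (window_comparison x V (fun m => G * m%:R)) => // {}k.
      by move=> /nojump /ltW.
    move=> Kk; have k0 : (0 < k)%N by exact: leq_trans Kk.
    apply: le_trans (V_super k k0); rewrite lerD2l mulrDr mulr1 mulrDl lerD//.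
      apply: (le_trans hK); rewrite ler_wpM2l// ler_weXn2l// ltW//.
    apply: (le_trans (G_le k)); rewrite ler_wpM2r//.
    by rewrite (ler_peMl C3_ge0).
  split => //; rewrite (history_cat x K m)//.
  rewrite /C4 mulrDr mulr1 mulrDl lerD//.
    apply: (le_trans hK); rewrite ler_wpM2l// (le_trans (mucX K))//.
    by rewrite ler_weXn2l// ltW.
  apply: (@le_trans _ _ (W * \sum_(1 <= i < m + D) H * M1 * c ^+ i)).
    rewrite ler_wpM2l// [leRHS](@big_cat_nat _ _ _ (K + D))//=; last 2 first.
    - by rewrite addn_gt0 Kpos.
    - by rewrite leq_add2r.
    rewrite -[leLHS]add0r lerD//.
      rewrite sumr_ge0// => i _.
      exact: mulr_ge0 (mulr_ge0 H_ge0 M1_ge0) (cX0 i).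
    rewrite big_nat_cond [leRHS]big_nat_cond; apply: ler_sum => i.
    rewrite andbT => /andP[Ki im].
    have Di : (D <= i)%N by rewrite (leq_trans _ Ki)// leq_addl.
    apply: le_trans (V_le i); rewrite -(subnK Di); apply: xV.
    by rewrite leq_subRL// addnC Ki/= ltn_subLR// addnC.
  rewrite -mulr_sumr sum_expr_nat ?addn_gt0 ?(leq_trans Kpos Km)//.
  rewrite exprD.
  have -> : H * (W * M1 * c ^+ D / (c - 1)) * c ^+ m =
     W * (H * M1 * ((c ^+ m * c ^+ D) / (c - 1))) by ring.
  rewrite ler_wpM2l// (ler_wpM2l (mulr_ge0 H_ge0 M1_ge0))// ler_pM2r ?invr_gt0//.
  by rewrite gerBl ltW.
(* All constants scale linearly in [H], so the threshold [K0] could be fixed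
   before [H]; [history x K <= H * mu ^+ K] is the state restored at [m * m]. *)
pose B := H * (M1 + C5).
exists B, (K0 + D)%N => n Kn.
have Dn : (D <= n)%N by rewrite (leq_trans _ Kn)// leq_addl.
suff main K k : (K0 <= K)%N -> (K <= k)%N -> history x K <= H * mu ^+ K ->
    x (k + D)%N <= B * c ^+ (k + D).
  rewrite -(subnK Dn); apply: (main K0) => //.
    by rewrite leq_subRL// addnC.
  by apply: (@le_trans _ _ H); [rewrite lerDr | rewrite ler_peMr].
have [r] := ubnP (k - K); elim: r K => // r IH K rk K0K Kk hK.
have Kpos : (0 < K)%N by rewrite (leq_trans _ K0K)// ltnW.
case: (pselect (exists m, (K <= m <= k)%N &&
    (history x m + G * m%:R <= window x m))) => [exm|nom]; last first.
  have [] := quiet_phase K k.+1 Kpos (leqW Kk) hK.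
    move=> j Kj; rewrite ltNge; apply/negP => hj; apply: nom.
    by exists j; rewrite hj -ltnS Kj.
  move=> xV _; have := xV k; rewrite Kk ltnSn => /(_ isT)/le_trans; apply.
  apply: (le_trans (V_le _)).
  by rewrite ler_wpM2r// ler_wpM2l// lerDl.
(* Taking the first jump leaves the interval from [K] to [m] quiet. *)
case: (ex_minnP exm) => m /andP[/andP[Km mk] jump] min_m.
have m0 : (0 < m)%N by exact: leq_trans Km.
have [] := quiet_phase K m Kpos Km hK.
  move=> j /andP[Kj jm]; rewrite ltNge; apply/negP => hj.
  have := min_m j; rewrite Kj hj (ltnW (leq_trans jm mk)) => /(_ isT).
  by rewrite leqNgt jm.
move=> _ hm.
have wn j : (m <= j <= m * m)%N -> window x j <= H * C5 * c ^+ m.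
  move=> mj; have := slow_after_jump m j m0 mj jump.
  rewrite -ler_pdivlMl// => /le_trans; apply.
  rewrite /C5 mulrC mulrA -mulrAC ler_pM2r ?invr_gt0//.
  rewrite mulrDr mulrDl lerD// mulrC mulrA.
  by rewrite ler_peMl// mulr_ege1.
have xn j : (m <= j <= m * m)%N -> x (j + D)%N <= H * C5 * c ^+ m.
  move=> mj; apply: le_trans (wn j mj); apply: window_ge_last => //.
  by move: mj => /andP[mj _]; exact: leq_trans mj.
have [kmm|mmk] := leqP k (m * m).
  apply: (@le_trans _ _ (H * C5 * c ^+ m)); first by rewrite xn// mk.
  apply: ler_pM => //; first exact: mulr_ge0 H_ge0 C5_ge0.
    by rewrite ler_wpM2l// lerDr.
  by rewrite ler_weXn2l ?(ltW c_gt1)// (leq_trans mk)// leq_addr.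
have m1 : (1 < m)%N by rewrite (leq_trans K0_gt1)// (leq_trans K0K).
have m_mm : (m < m * m)%N by rewrite -{1}[m]muln1 ltn_pmul2l.
apply: (IH (m * m)%N) => //.
- rewrite (leq_trans (ltn_sub2l (ltn_trans m_mm mmk) m_mm))// -ltnS.
  by rewrite (leq_ltn_trans _ rk)// leq_sub2l.
- by rewrite (leq_trans K0K)// (leq_trans Km)// ltnW.
- exact: ltnW.

(* The invariant is restored at [m * m]: the stall adds at most [m * m] terms of size
   [H * C5 * c ^+ m], and the total is below [H * mu ^+ (m * m)] by the choice of [K0]. *)
rewrite (history_cat x m (m * m))//; last exact: ltnW.
apply: (@le_trans _ _ (H * (C6 * (m * m)%:R * c ^+ m))); last first.
  by rewrite ler_wpM2l// K0P// (leq_trans K0K).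
have sum_le : \sum_(m + D <= i < m * m + D) x i <= (m * m)%:R * (H * C5 * c ^+ m).
  apply: (@le_trans _ _ (\sum_(m + D <= i < m * m + D) H * C5 * c ^+ m)).
    rewrite big_nat_cond [leRHS]big_nat_cond; apply: ler_sum => i.
    rewrite andbT => /andP[mi im].
    have Di : (D <= i)%N by rewrite (leq_trans _ mi)// leq_addl.
    rewrite -(subnK Di); apply: xn.
    by rewrite leq_subRL// addnC mi/= leq_subLR addnC ltnW.
  rewrite sumr_const_nat -[leLHS]mulr_natl.
  rewrite (ler_wpM2r (mulr_ge0 (mulr_ge0 H_ge0 C5_ge0) (cX0 m)))//.
  by rewrite ler_nat leq_subLR -addnA [(D + _)%N]addnC leq_addl.
apply: (@le_trans _ _ (H * C4 * c ^+ m + W * ((m * m)%:R * (H * C5 * c ^+ m)))).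
  by rewrite lerD// ler_wpM2l.
have -> : H * (C6 * (m * m)%:R * c ^+ m) =
    H * C4 * c ^+ m * (m * m)%:R + W * ((m * m)%:R * (H * C5 * c ^+ m)).
  by rewrite /C6; ring.
rewrite lerD2r ler_peMr ?ler1n ?muln_gt0 ?m0//.
exact: mulr_ge0 (mulr_ge0 H_ge0 (le_trans ler01 C4_ge1)) (cX0 m).
Qed.

End Dynamics.

End LinearRecurrence.

(** * Logarithms of products and convergence of power series sums *)

Lemma ln_prod_nat {R : realType} (I : Type) (r : seq I) (P : pred I)
    (F : I -> nat) : (forall i, P i -> (0 < F i)%N) ->
  ln (\prod_(i <- r | P i) F i)%N%:R = \sum_(i <- r | P i) ln (F i)%:R :> R.
Proof.
move=> F0; suff [] : (0 < \prod_(i <- r | P i) F i)%N /\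
    ln (\prod_(i <- r | P i) F i)%N%:R = \sum_(i <- r | P i) ln (F i)%:R :> R by [].
apply: (big_ind2 (fun (n : nat) (y : R) => (0 < n)%N /\ ln n%:R = y)).
- by rewrite ln1.
- move=> n1 y1 n2 y2 [n10 <-] [n20 <-]; rewrite muln_gt0 n10 n20 natrM.
  by rewrite lnM// posrE ltr0n.
- by move=> i Pi; rewrite F0.
Qed.

(** With [N = n + 1], [ln n <= ln N - 1 / N] gives [n ^ (- s) >= N ^ (- s) * exp (s / N)], and
    [exp (s / N) >= 1 + s / N]. This replaces the integral comparison by a telescoping sum. *)
Lemma powR_telescope_le {R : realType} (s : R) (n : nat) : 0 < s -> (0 < n)%N ->
  n.+1%:R `^ (- (1 + s)) <= s^-1 * (n%:R `^ (- s) - n.+1%:R `^ (- s)).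
Proof.
move=> s0 n0; set N : R := n.+1%:R.
have N0 : 0 < N by rewrite ltr0n.
have nR0 : 0 < n%:R :> R by rewrite ltr0n.
have lnn : ln n%:R <= ln N - N^-1 :> R.
  have -> : n%:R = N * (1 - N^-1) :> R.
    by rewrite mulrBr mulr1 divff ?gt_eqF// /N -natr1 addrK.
  have N1 : 0 < 1 - N^-1 by rewrite subr_gt0 invf_lt1 ?ltr1n.
  rewrite lnM ?posrE// lerD2l le_ln1Dx//.
  by rewrite ltrN2 invf_lt1 ?ltr1n.
clearbody N; rewrite opprD powRD; last by rewrite (gt_eqF N0) implybT.
rewrite (powR_inv1 (ltW N0)) ler_pdivlMl// lerBrDr.
rewrite [leRHS]/powR gt_eqF//.
apply: (@le_trans _ _ (expR (- s * ln N + s / N))); last first.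
  rewrite ler_expR.
  have := lnn; rewrite -(ler_pM2l s0) mulrBr; lra.
rewrite expRD /powR gt_eqF//.
have : 1 + s / N <= expR (s / N) by exact: expR_ge1Dx.
rewrite -(ler_pM2l (expR_gt0 (- s * ln N))); lra.
Qed.

Lemma powR_series_bounded {R : realType} (s : R) : 0 < s ->
  exists2 C : R, 1 <= C & forall m n, (0 < m)%N ->
    \sum_(m <= i < n) i%:R `^ (- (1 + s)) <= C.
Proof.
move=> s0; exists (1 + s^-1); first by rewrite lerDl invr_ge0 ltW.
have bnd n : \sum_(1 <= i < n.+2) i%:R `^ (- (1 + s)) <=
    1 + s^-1 * (1 - n.+1%:R `^ (- s)).
  elim: n => [|n IH]; first by rewrite big_nat1 powR1 subrr mulr0 addr0.
  rewrite big_nat_recr//=; apply: (le_trans (lerD IH (powR_telescope_le s n.+1 s0 isT))).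
  lra.
move=> m n m0; have [nm|mn] := leqP n m.
  by rewrite big_geq// addr_ge0// invr_ge0 ltW.
case: n mn => [//|[|n]] mn; first by rewrite big_geq ?addr_ge0// invr_ge0 ltW.
apply: (@le_trans _ _ (\sum_(1 <= i < n.+2) i%:R `^ (- (1 + s)))).
  rewrite [leRHS](@big_cat_nat _ _ _ m)//=; last exact: ltnW.
  by rewrite lerDr sumr_ge0// => i _; exact: powR_ge0.
by apply: (le_trans (bnd n)); rewrite lerD2l ler_piMr ?invr_ge0 ?(ltW s0).
Qed.

(** * The weighted series: common denominators, tails and the effect of rationality *)

Section WeightedSeries.
Context {R : realType} {D : nat} (w : D.+1.-tuple nat) (a b : nat -> nat).
Variables (eta tau : R).
Hypothesis a_gt0 : forall n : nat, (1 <= n)%N -> (0 < a n)%N.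
Hypothesis b_gt0 : forall n : nat, (1 <= n)%N -> (0 < b n)%N.
Hypothesis a_nondecreasing :
  forall m n : nat, (1 <= m)%N -> (m <= n)%N -> (a m <= a n)%N.
Hypothesis eta_gt0 : 0 < eta.
Hypothesis eta_lt_tau : eta < tau.
Hypothesis b_le : forall n : nat, (1 <= n)%N -> (b n)%:R <= n%:R `^ eta.
Hypothesis prod_ge : forall n : nat, (1 <= n)%N ->
  n%:R `^ (1 + tau) <= (weighted_prod w a n)%:R.

Let W := max_weight w.
Let v (j : nat) : R := (nth 0%N w j)%:R.
Let x (i : nat) : R := ln (a i)%:R.
Let A (n : nat) : nat := weighted_prod w a n.
Let L (n : nat) : nat := (\prod_(1 <= i < n + D) a i ^ W)%N.
Let partial_sum (N : nat) : R := \sum_(1 <= n < N) (b n)%:R / (A n)%:R.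

Lemma nth_le_max_weight (j : nat) : (nth 0 w j <= W)%N.
Proof.
have [jD|Dj] := ltnP j D.+1; first exact: (leq_bigmax (Ordinal jD)).
by rewrite nth_default// size_tuple.
Qed.

Lemma weighted_prod_gt0 (n : nat) : (0 < n)%N -> (0 < A n)%N.
Proof.
move=> n0; rewrite /A /weighted_prod prodn_gt0// => j.
by rewrite expn_gt0 a_gt0// addn_gt0 n0.
Qed.

Lemma denominator_gt0 (n : nat) : (0 < L n)%N.
Proof.
rewrite /L big_nat_cond prodn_cond_gt0// => i; rewrite andbT => /andP[i0 _].
by rewrite expn_gt0 a_gt0.
Qed.

Lemma weighted_prod_le (m n : nat) : (0 < m)%N -> (m <= n)%N -> (A m <= A n)%N.
Proof.
move=> m0 mn; apply: leq_prod => j _.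
have [->//|wj0] := posnP (nth 0%N w j).
by rewrite leq_exp2r// a_nondecreasing ?addn_gt0 ?m0// leq_add2r.
Qed.

(** The factors of [A n] have indices from [n] to [n + D] and exponents at most [W]; as [n < N],
    this block lies in the index range of [L N]. *)
Lemma weighted_prod_dvd (n N : nat) : (0 < n)%N -> (n < N)%N -> (A n %| L N)%N.
Proof.
move=> n0 nN; apply: (@dvdn_trans (\prod_(n <= i < n + D.+1) a i ^ W)%N).
  rewrite -[X in (\prod_(X <= _ < _) _)%N]add0n big_addn addKn big_mkord.
  apply: (big_ind2 (fun m k => m %| k)%N) => // [m1 k1 m2 k2|j _].
    exact: dvdn_mul.
  by rewrite addnC dvdn_exp2l// nth_le_max_weight.
rewrite /L (@big_cat_nat _ _ _ n 1)//=; last exact: leq_trans (ltnW nN) (leq_addr _ _).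
rewrite (@big_cat_nat _ _ _ (n + D.+1) n (N + D))//= ?leq_addr//; last first.
  by rewrite addnS -addSn leq_add2r.
by rewrite dvdn_mull// dvdn_mulr.
Qed.

Lemma ln_weighted_prod (n : nat) : (0 < n)%N ->
  ln (A n)%:R = window D v x n.
Proof.
move=> n0; have an0 j : (0 < a (n + j))%N by rewrite a_gt0// addn_gt0 n0.
rewrite /A /weighted_prod ln_prod_nat; last by move=> j _; rewrite expn_gt0 an0.
apply: eq_bigr => j _.
by rewrite natrX lnXn ?ltr0n// -[LHS]mulr_natl.
Qed.

Lemma ln_denominator (n : nat) : ln (L n)%:R = history D W%:R x n.
Proof.
rewrite /L /history big_nat_cond ln_prod_nat; last first.
  by move=> i; rewrite andbT => /andP[i0 _]; rewrite expn_gt0 a_gt0.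
rewrite -big_nat_cond mulr_sumr big_nat_cond [RHS]big_nat_cond.
apply: eq_bigr => i; rewrite andbT => /andP[i0 _].
by rewrite natrX lnXn ?ltr0n ?a_gt0// -[LHS]mulr_natl.
Qed.

(** Half of the gap keeps the exponent [1 + s] summable. The other half defines [kappa], through
    [(1 - kappa) * (1 + tau) = 1 + eta + s]. *)
Let s : R := (tau - eta) / 2.
Let kappa : R := s / (1 + tau).

Let s_gt0 : 0 < s. Proof. by rewrite divr_gt0// subr_gt0. Qed.

Let tau_gt0 : 0 < 1 + tau.
Proof. by rewrite addr_gt0// (lt_trans eta_gt0). Qed.

Let kappa_gt0 : 0 < kappa. Proof. by rewrite divr_gt0. Qed.

(* Interpolates between [A n >= A N] and [A n >= n ^ (1 + tau)]. *)
Lemma weighted_term_le (N n : nat) : (0 < N)%N -> (N <= n)%N ->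
  (b n)%:R / (A n)%:R <= (A N)%:R `^ (- kappa) * n%:R `^ (- (1 + s)).
Proof.
move=> N0 Nn; have n0 : (0 < n)%N by exact: leq_trans Nn.
have An0 : 0 < (A n)%:R :> R by rewrite ltr0n weighted_prod_gt0.
have AN0 : 0 < (A N)%:R :> R by rewrite ltr0n weighted_prod_gt0.
have nR0 : 0 < n%:R :> R by rewrite ltr0n.
have lnb : ln (b n)%:R <= eta * ln n%:R :> R.
  by rewrite -ln_powR ler_ln ?posrE ?powR_gt0 ?ltr0n ?b_gt0// b_le.
have lnA : (1 + tau) * ln n%:R <= ln (A n)%:R :> R.
  by rewrite -ln_powR ler_ln ?posrE ?powR_gt0// prod_ge.
have lnAN : ln (A N)%:R <= ln (A n)%:R :> R.
  by rewrite ler_ln ?posrE// ler_nat weighted_prod_le.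
rewrite -ler_ln ?posrE; last 2 first.
- by rewrite divr_gt0// ltr0n b_gt0.
- by rewrite mulr_gt0// powR_gt0.
rewrite ln_div ?posrE ?ltr0n ?b_gt0// ?weighted_prod_gt0//.
rewrite lnM ?posrE ?powR_gt0// !ln_powR.
have k1 : 0 < 1 - kappa.
  rewrite subr_gt0 /kappa ltr_pdivrMr// mul1r /s; move: eta_gt0 eta_lt_tau; lra.
have E1 : (1 - kappa) * (1 + tau) = 1 + eta + s.
  by rewrite mulrBl mul1r divfK ?gt_eqF// /s; field.
have := ler_wpM2l (ltW k1) lnA; rewrite mulrA E1.
have := ler_wpM2l (ltW kappa_gt0) lnAN.
have : 0 <= ln n%:R :> R by rewrite ln_ge0// ler1n.
move: (ln (A n)%:R) (ln (A N)%:R) (ln n%:R) (ln (b n)%:R) lnb => yn yN l lb.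
lra.
Qed.

Lemma partial_sum_cat (m n : nat) : (0 < m)%N -> (m <= n)%N ->
  partial_sum n = partial_sum m + \sum_(m <= i < n) (b i)%:R / (A i)%:R.
Proof. by move=> m0 mn; rewrite /partial_sum -big_cat_nat. Qed.

Lemma weighted_term_gt0 (n : nat) : (0 < n)%N -> 0 < (b n)%:R / (A n)%:R :> R.
Proof. by move=> n0; rewrite divr_gt0 ?ltr0n ?b_gt0 ?weighted_prod_gt0. Qed.

Lemma partial_sum_nondecreasing : nondecreasing_seq partial_sum.
Proof.
move=> m n mn; have [m0|m0] := posnP m.
  by rewrite m0 /partial_sum [leLHS]big_geq// sumr_ge0.
by rewrite (partial_sum_cat m n)// lerDl sumr_ge0.
Qed.

Lemma partial_sum_tail_le : exists2 C : R, 1 <= C & forall N n, (0 < N)%N ->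
  (N <= n)%N -> partial_sum n - partial_sum N <= C * (A N)%:R `^ (- kappa).
Proof.
have [C C1 CP] := powR_series_bounded s s_gt0; exists C => // N n N0 Nn.
rewrite (partial_sum_cat N n)// addrC addKr.
apply: (@le_trans _ _ (\sum_(N <= i < n)
    (A N)%:R `^ (- kappa) * i%:R `^ (- (1 + s)))).
  rewrite big_nat_cond [leRHS]big_nat_cond; apply: ler_sum => i.
  by rewrite andbT => /andP[Ni _]; exact: weighted_term_le.
by rewrite -mulr_sumr mulrC ler_wpM2r ?powR_ge0// CP.
Qed.

Lemma is_cvg_partial_sum : cvgn partial_sum.
Proof.
apply: nondecreasing_is_cvgn; first exact: partial_sum_nondecreasing.
have [C C1 CP] := partial_sum_tail_le.
exists (C * (A 1)%:R `^ (- kappa)) => _ [n _ <-].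
have [n0|n0] := posnP n.
  rewrite n0 /partial_sum [leLHS]big_geq// mulr_ge0 ?powR_ge0//.
  exact: le_trans C1.
by have := CP 1%N n isT n0; rewrite [partial_sum 1]big_geq// subr0.
Qed.

Let tail (N : nat) : R := limn partial_sum - partial_sum N.

Lemma tail_gt0 (N : nat) : (0 < N)%N -> 0 < tail N.
Proof.
move=> N0; rewrite subr_gt0.
have := nondecreasing_cvgn_le partial_sum_nondecreasing is_cvg_partial_sum N.+1.
apply: lt_le_trans; rewrite (partial_sum_cat N N.+1)// big_nat1 ltrDl.
exact: weighted_term_gt0.
Qed.

Lemma tail_le : exists2 C : R, 1 <= C & forall N, (0 < N)%N ->
  tail N <= C * (A N)%:R `^ (- kappa).
Proof.
have [C C1 CP] := partial_sum_tail_le; exists C => // N N0.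
rewrite lerBlDr; apply: limr_le; first exact: is_cvg_partial_sum.
by exists N => // n /= Nn; rewrite -lerBlDr; exact: CP.
Qed.

(* [L N] clears the denominators of [partial_sum N]. *)
Lemma rational_tail_ge : rational (limn partial_sum) ->
  exists2 q : nat, (0 < q)%N & forall N, (0 < N)%N ->
    1 <= q%:R * (L N)%:R * tail N.
Proof.
move=> /rationalP[p [q pq]].
have lim0 : 0 < limn partial_sum.
  by have := tail_gt0 1 isT; rewrite /tail {2}/partial_sum big_geq// subr0.
(* With [q = 0] the quotient would be 0 by convention, which positivity of the limit excludes. *)
have q0 : (0 < q)%N.
  rewrite lt0n; apply: contraTneq lim0 => q0.
  by rewrite pq q0 invr0 mulr0 ltxx.
exists q => // N N0.
pose k := (\sum_(1 <= n < N) b n * (L N %/ A n))%N.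
have kE : k%:R = (L N)%:R * partial_sum N :> R.
  rewrite /k natr_sum /partial_sum mulr_sumr.
  rewrite big_nat_cond [RHS]big_nat_cond; apply: eq_bigr => n.
  rewrite andbT => /andP[n0 nN]; rewrite natrM natf_div ?weighted_prod_dvd//.
  by rewrite mulrCA.
have qlim : q%:R * limn partial_sum = p%:~R.
  by rewrite pq mulrC divfK// pnatr_eq0 -lt0n.
have zE : q%:R * (L N)%:R * tail N = ((L N)%:Z * p - (q * k)%:Z)%:~R.
  rewrite intrB intrM -!pmulrn natrM kE -qlim /tail; ring.
have : 0 < q%:R * (L N)%:R * tail N.
  by rewrite !mulr_gt0 ?ltr0n ?denominator_gt0 ?tail_gt0.
by rewrite zE ltr0z ler1z -gtz0_ge1.
Qed.

(** A jump makes the terms from [m] to [n] cost at most half of the lower bound on [tail m]. The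
    surviving half bounds [tail n] from below; comparing with [tail_le] and taking logarithms bounds
    [A n]. *)
Lemma rational_slow_after_jump : rational (limn partial_sum) ->
  exists C0 G : R, [/\ 0 <= C0, 0 <= G &
    forall m n, (0 < m)%N -> (m <= n <= m * m)%N ->
      history D W%:R x m + G * m%:R <= window D v x m ->
      kappa * window D v x n <= C0 + history D W%:R x m].
Proof.
move=> /rational_tail_ge[q q0 qP]; have [C C1 CP] := tail_le.
have qR0 : 0 < q%:R :> R by rewrite ltr0n.
have q2 : 1 <= 2 * q%:R :> R by rewrite -natrM ler1n muln_gt0.
have q2_gt0 : 0 < 2 * q%:R :> R by exact: lt_le_trans q2.
have C_gt0 : 0 < C by exact: lt_le_trans C1.
(* [G * m] has to exceed [ln (2 * q) + (1 + eta) * ln (m * m)], which follows from [ln m <= m] and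
   [1 <= m]. *)
exists (ln (2 * q%:R * C)), (ln (2 * q%:R) + 2 * (1 + eta)); split.
- by rewrite ln_ge0// mulr_ege1.
- by rewrite addr_ge0 ?ln_ge0// mulr_ge0// addr_ge0// ltW.
move=> m n m0 /andP[mn nmm]; have n0 : (0 < n)%N by exact: leq_trans mn.
rewrite -!ln_weighted_prod// -ln_denominator => jump.
have L0 : 0 < (L m)%:R :> R by rewrite ltr0n denominator_gt0.
have Am0 : 0 < (A m)%:R :> R by rewrite ltr0n weighted_prod_gt0.
have An0 : 0 < (A n)%:R :> R by rewrite ltr0n weighted_prod_gt0.
have mm0 : 0 < (m * m)%:R :> R by rewrite ltr0n muln_gt0 m0.
have gap : 2 * q%:R * (L m)%:R * (m * m)%:R `^ (1 + eta) <= (A m)%:R.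
  rewrite -ler_ln ?posrE ?mulr_gt0 ?powR_gt0//.
  rewrite !lnM ?posrE ?mulr_gt0 ?powR_gt0// ln_powR natrM lnM ?posrE ?ltr0n//.
  move: jump; rewrite lnM ?posrE// => jump.
  apply: le_trans jump.
  have lnm : ln m%:R <= m%:R :> R by rewrite ltW// ln_sublinear// ltr0n.
  have m1 : 1 <= m%:R :> R by rewrite ler1n.
  have q20 : 0 <= ln 2 + ln q%:R :> R.
    by rewrite addr_ge0// ln_ge0 ?ler1n.
  have e0 : 0 <= 1 + eta by rewrite addr_ge0// ltW.
  have := ler_wpM2l e0 lnm; have := ler_wpM2l q20 m1.
  move: (ln (L m)%:R) (ln m%:R) (ln 2) (ln q%:R) => l1 l2 l3 l4.
  lra.
have sum_le : \sum_(m <= i < n) (b i)%:R / (A i)%:R <=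
    (m * m)%:R `^ (1 + eta) / (A m)%:R.
  apply: (@le_trans _ _ (\sum_(m <= i < n) (m * m)%:R `^ eta / (A m)%:R)).
    rewrite big_nat_cond [leRHS]big_nat_cond; apply: ler_sum => i.
    rewrite andbT => /andP[mi ni]; have i0 : (0 < i)%N by exact: leq_trans mi.
    apply: ler_pM => //; last first.
      rewrite lef_pV2 ?posrE ?ltr0n ?weighted_prod_gt0//.
      by rewrite ler_nat weighted_prod_le.
    rewrite (le_trans (b_le i i0))// ge0_ler_powR ?nnegrE ?(ltW eta_gt0)// ler_nat.
    by rewrite (leq_trans (ltnW ni)).
  rewrite sumr_const_nat -[leLHS]mulr_natl mulrA ler_pM2r ?invr_gt0//.
  rewrite powRD; last by rewrite (gt_eqF mm0) implybT.
  rewrite powRr1// ler_wpM2r ?powR_ge0// ler_nat.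
  by rewrite (leq_trans (leq_subr _ _)).
have tailE : tail n = tail m - \sum_(m <= i < n) (b i)%:R / (A i)%:R.
  by rewrite /tail (partial_sum_cat m n)//; ring.
have tail_ge : 1 <= 2 * q%:R * (L m)%:R * tail n.
  have gap' : 2 * q%:R * (L m)%:R * ((m * m)%:R `^ (1 + eta) / (A m)%:R) <= 1.
    by rewrite mulrA ler_pdivrMr// mul1r.
  have c0 : 0 <= 2 * q%:R * (L m)%:R :> R by rewrite !mulr_ge0.
  have := le_trans (ler_wpM2l c0 sum_le) gap'.
  have := qP m m0; rewrite tailE; lra.
have P0 : 0 < (A n)%:R `^ (- kappa) :> R by rewrite powR_gt0.
have X0 : 0 < 2 * q%:R * C by rewrite mulr_gt0.
have Y0 : 0 < (L m)%:R * (A n)%:R `^ (- kappa) :> R by rewrite mulr_gt0.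
have : 0 <= ln (2 * q%:R * C * ((L m)%:R * (A n)%:R `^ (- kappa))) :> R.
  rewrite ln_ge0// mulrACA; apply: (le_trans tail_ge).
  by rewrite ler_wpM2l ?CP.
rewrite (lnM X0 Y0) (lnM L0 P0) ln_powR; lra.
Qed.

(** * Contradiction with the limsup hypothesis *)

Lemma limn_esup_root_lty (c : R) (B : R) (N : nat) : 0 < c ->
  (forall n, (N <= n)%N -> x n <= B * c ^+ n) ->
  (limn_esup (fun n : nat => ((a n)%:R `^ (1 / c ^+ n))%:E) < +oo)%E.
Proof.
move=> c0 xB; apply: (@le_lt_trans _ _ (expR B)%:E); last exact: ltry.
rewrite limn_esup_lim; apply: lime_le; first exact: is_cvg_esups.
(* Starting past [N] forces positive indices, since [a 0] is unconstrained. *)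
exists N.+1 => // n /= Nn; apply: ge_ereal_sup => _ [k /= nk <-].
have Nk : (N < k)%N by exact: leq_trans nk.
have k0 : (0 < k)%N by exact: leq_ltn_trans Nk.
rewrite lee_fin /powR gt_eqF ?ltr0n ?a_gt0// ler_expR mul1r.
by rewrite ler_pdivrMl ?exprn_gt0// mulrC xB// ltnW.
Qed.

Lemma weight_polyE (z : R) : (weight_poly R w).[z] = char_fun D v W%:R z.
Proof.
rewrite /weight_poly /char_fun !hornerE horner_sum; congr (_ * _ - _).
by apply: eq_bigr => j _; rewrite !hornerE.
Qed.

Lemma irrational_lim_partial_sum (c : R) : (0 < nth 0 w D)%N -> 0 < c ->
  root (weight_poly R w) c ->
  limn_esup (fun n : nat => ((a n)%:R `^ (1 / c ^+ n))%:E) = +oo%E ->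
  irrational (limn partial_sum).
Proof.
move=> wD c0 /rootP; rewrite weight_polyE => Pc limsup_a rat.
have v0 j : 0 <= v j by [].
have vW j : v j <= W%:R by rewrite ler_nat nth_le_max_weight.
have vD : 1 <= v D by rewrite ler1n.
have c1 := char_fun_root_gt1 D v W%:R v0 vW vD c c0 Pc.
have x0 i : (0 < i)%N -> 0 <= x i by move=> i0; rewrite ln_ge0// ler1n a_gt0.
have [C0 [G [C00 G0 slow]]] := rational_slow_after_jump rat.
have [B [N xB]] := window_exp_bounded D v W%:R v0 vW vD x c kappa C0 G x0 c1 Pc
  kappa_gt0 C00 G0 slow.
by have := limn_esup_root_lty c B N c0 xB; rewrite limsup_a ltxx.
Qed.

End WeightedSeries.

Theorem theorem2 (R : realType) (d : nat) (w : d.-tuple nat) (c : R)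
  (a b : nat -> nat) (eta tau : R)
  (d_gt0 : (0 < d)%N)
  (wlast_ge1 : (1 <= nth 0 w d.-1)%N)
  (c_gt0 : 0 < c)
  (c_root : root (weight_poly R w) c)
  (a_gt0 : forall n : nat, (1 <= n)%N -> (0 < a n)%N)
  (b_gt0 : forall n : nat, (1 <= n)%N -> (0 < b n)%N)
  (a_nondecreasing :
    forall m n : nat, (1 <= m)%N -> (m <= n)%N -> (a m <= a n)%N)
  (eta_gt0 : 0 < eta)
  (eta_lt_tau : eta < tau)
  (b_le : forall n : nat, (1 <= n)%N -> (b n)%:R <= n%:R `^ eta)
  (prod_ge : forall n : nat, (1 <= n)%N ->
    n%:R `^ (1 + tau) <= (weighted_prod w a n)%:R)
  (limsup_a : limn_esup (fun n : nat => ((a n)%:R `^ (1 / c ^+ n))%:E) = +oo%E) :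
  let partial_sum : R ^nat := fun N : nat =>
    \sum_(1 <= n < N) ((b n)%:R / (weighted_prod w a n)%:R) in
  cvgn partial_sum /\ irrational (limn partial_sum).
Proof.
case: d w d_gt0 wlast_ge1 c_root prod_ge => // D w _ wD c_root prod_ge /=.
split; first exact: (is_cvg_partial_sum w a b eta tau).
exact: (irrational_lim_partial_sum w a b eta tau) limsup_a.
Qed.
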